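(* Let $F$ be a graph with $\delta(F)\geqslant 1$ and suppose there is a constant $D$ depending on $F$ such that $\mathrm{wsat}(n,F)\geqslant(\delta(F)-1)n+D$ for all $n$. Then there exist a positive integer $k$ and a constant $d_F$ such that $\mathrm{wsat}(n,F)=(\delta(F)-1)n+d_F$ for all sufficiently large $n$ and, for any $p=p(n)$ with $p\geqslant n^{-1/(2k+3)}\log n$, $\mathrm{wsat}(\mathbb{G}(n,p),F)=\mathrm{wsat}(n,F)$ with high probability.
   Context: All graphs are finite, undirected, without loops or multiple edges. $\delta(F)$ is the minimum degree of $F$. For graphs $G$ and $F$, a graph $H$ is weakly $(G,F)$-saturated if $H$ is a spanning subgraph of $G$ which has no copy of $F$ as a (not necessarily induced) subgraph and there is an ordering $e_1,e_2,\dots$ of the edges in $E(G)\setminus E(H)$ such that for each $i$ the spanning subgraph of $G$ with edge set $E(H)\cup\{e_1,\dots,e_i\}$ has a copy of $F$ containing $e_i$. The weak saturation number $\mathrm{wsat}(G,F)$ is the minimum number of edges in a weakly $(G,F)$-saturated graph, and $\mathrm{wsat}(n,F)=\mathrm{wsat}(K_n,F)$, where $K_n$ is the complete graph on $n$ vertices. $\mathbb{G}(n,p)$ is the Erdős–Rényi random graph on a fixed set of $n$ vertices, where every two distinct vertices are adjacent independently with probability $p$; here $p=p(n)\in[0,1]$ may depend on $n$, and lower bounds on $p$ are understood for sufficiently large $n$. ''With high probability'' means with probability tending to $1$ as $n\to\infty$. The graph $F$ is fixed (independent of $n$). *)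

(* Defs.v *)
From HB Require Import structures.
From mathcomp Require Import all_boot all_order all_algebra.
From mathcomp Require Import boolp reals.

Set Implicit Arguments.
Unset Strict Implicit.
Unset Printing Implicit Defensive.

Import GRing.Theory.

Section Graphs.
Variable V : finType.

Definition pairs : {set {set V}} := [set e : {set V} | #|e| == 2].

(* A simple graph with vertex set V, given by its set of edges. *)
Record graph : Type := Graph {
  edges : {set {set V}};
  _ : edges \subset pairs }.

HB.instance Definition _ := [isSub for edges].
HB.instance Definition _ := [Finite of graph by <:].

Definition complete : graph := Graph (subxx pairs).

Definition degree (G : graph) (v : V) : nat := #|[set e in edges G | v \in e]|.

(* Degrees are smaller than #|V|, so the default value #|V| does not affect
   the minimum, except that the graph without vertices gets min_degree 0. *)
Definition min_degree (G : graph) : nat :=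
  \big[minn/#|V|]_(v : V) degree G v.

End Graphs.

Arguments complete V : clear implicits.

Section WeakSaturation.
Variables V U : finType.

(* f maps F onto a (not necessarily induced) copy of F in the graph on V with
   edge set E; the edges of this copy are the sets f @: e for e \in edges F. *)
Definition copy_map (E : {set {set V}}) (F : graph U) (f : U -> V) : Prop :=
  injective f /\ forall e, e \in edges F -> f @: e \in E.

Definition has_copy (E : {set {set V}}) (F : graph U) : Prop :=
  exists f : U -> V, copy_map E F f.

Definition has_copy_through (E : {set {set V}}) (F : graph U) (e : {set V})
    : Prop :=
  exists2 f : U -> V, copy_map E F f &
    exists2 e', e' \in edges F & f @: e' = e.

Definition weakly_saturated (G : graph V) (F : graph U) (H : graph V) : Prop :=
  [/\ edges H \subset edges G,
      ~ has_copy (edges H) F &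
      exists s : seq {set V},
        [/\ uniq s,
            [set:: s] = edges G :\: edges H &
            forall i, i < size s ->
              has_copy_through (edges H :|: [set:: take i.+1 s]) F
                (nth set0 s i)]].

(* A weakly saturated H is a subgraph of G, so the default value #|edges G|
   does not affect the minimum. It is used only when no such H exists, which
   requires F to have no edges: otherwise, starting from G, one can delete
   edges lying in copies of F one at a time until no copy is left. *)
Definition wsat (G : graph V) (F : graph U) : nat :=
  \big[minn/#|edges G|]_(H : graph V | `[< weakly_saturated G F H >])
    #|edges H|.

End WeakSaturation.

Definition wsatK (U : finType) (n : nat) (F : graph U) : nat :=
  wsat (complete 'I_n) F.

(* Probability that the random graph G(n, p) on 'I_n satisfies A. *)
Definition Gnp_prob (R : realType) (n : nat) (p : R) (A : pred (graph 'I_n))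
    : R :=
  (\sum_(G : graph 'I_n | A G)
     \prod_(e in pairs 'I_n) (if e \in edges G then p else 1 - p))%R.

(* Main.v *)
Require Import Defs.
From mathcomp Require Import all_boot all_order all_algebra.
From mathcomp Require Import boolp reals.
From mathcomp Require Import zify ring lra.
Import Order.TTheory GRing.Theory Num.Theory.

(** Call a graph [extendable M] when every set of at most [M] vertices has a
    common neighbour.  For a constant [M], the threshold on [p] makes the
    random graph extendable with high probability: by a union bound it fails
    with probability at most [n ^ M * (1 - p ^ M) ^ (n - M)].  So it suffices to compute the weak saturation number of
    an arbitrary extendable graph [G] on [n] vertices.  The exponent of the
    threshold leaves room for any constant: [k := M] works.

    Write [d] for the minimum degree of [F].  Everything rests on one move
    ([activated_attach]): if all pairs inside a large set [B] have been
    activated, and [d - 1] edges from [v] to [B] as well, then any further edge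
    [vw] of [G] with [w] in [B] completes a copy of [F], in which [v] plays a
    vertex of minimum degree and the rest of the copy lies inside [B].

    Lower bound ([wsat_complete_le]).  In an extendable graph two non-adjacent
    vertices have a common clique of constant size in their neighbourhood, so
    the missing edge can be added by this move.  Hence an extendable [G]
    percolates to the complete graph, and the weak saturation number of [G] is
    at least that of the complete graph.

    Upper bound ([wsat_le_extendable]).  Fix [N] and a clique [K] of [N]
    vertices of [G]; place an optimal weakly saturated graph of the complete
    graph on [N] vertices inside [K].  Let [C] be the set of common neighbours
    of [K].  Every vertex of [C] sends [d - 1] edges to [K], every other
    vertex sends [d - 1] edges to a clique inside [C].  Now [K] is activated,
    then the edges from [C] to [K], then the edges inside [C].  The set [C] is
    rich: as a common neighbour of [K] and [S] lies in [C], every small set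
    [S] of vertices has common neighbours, even common cliques, inside [C].
    This lets all remaining edges be activated through [C].  The number of
    edges used is the weak saturation number for [N] plus [(d - 1)(n - N)].

    The complete graph is itself extendable, so the upper bound shows that the
    excess of the weak saturation number over [(d - 1) n], at a large [n], is
    at most its value at [N].  The excess is bounded below by hypothesis; at an
    [N] where it is minimal both bounds meet, which gives the constant [dF] and
    the equality for all extendable graphs on sufficiently many vertices. *)

Set Implicit Arguments.
Unset Strict Implicit.
Unset Printing Implicit Defensive.

(** * Activation of edges and the weak saturation number *)

Section Activation.
Local Open Scope nat_scope.
Local Open Scope set_scope.
Variables (V U : finType) (F : graph U).
Implicit Types (T E X : {set {set V}}) (G H : graph V).

(** The closure reached by the process inside the host [T] from the initial
    edges [E], without reference to an order in which the edges appear: this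
    makes monotonicity and transitivity immediate. *)
Inductive activated T E : {set V} -> Prop :=
| activated_init e of e \in E : activated T E e
| activated_copy (f : U -> V) e0 of injective f & e0 \in edges F
    & f @: e0 \in T
    & (forall e, e \in edges F -> e != e0 -> activated T E (f @: e)) :
    activated T E (f @: e0).

Definition percolates T E := forall e, e \in T -> activated T E e.

Lemma activated_sub T T' E e : T \subset T' -> activated T E e ->
  activated T' E e.
Proof.
move=> sTT'; elim=> [{}e eE|f e0 finj e0F fe0 _ IH]; first exact: activated_init.
by apply: activated_copy => //; apply: (subsetP sTT').
Qed.

Lemma activated_trans T E E' e : (forall e', e' \in E -> activated T E' e') ->
  activated T E e -> activated T E' e.
Proof.
move=> EE'; elim=> [{}e eE|f e0 finj e0F fe0 _ IH]; first exact: EE'.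
exact: activated_copy.
Qed.

(** An ordering can be built greedily: while some edge of [T] is missing from
    the current set [X], [X] is not closed under activation, so some missing
    edge can be added.  The ordering of [X :\: E] is the accumulator. *)
Lemma percolates_ordering T E X : E \subset X -> X \subset T ->
  percolates T E ->
  (exists s : seq {set V},
    [/\ uniq s, [set:: s] = X :\: E &
      forall i, i < size s ->
        has_copy_through (E :|: [set:: take i.+1 s]) F (nth set0 s i)]) ->
  exists s : seq {set V},
    [/\ uniq s, [set:: s] = T :\: E &
      forall i, i < size s ->
        has_copy_through (E :|: [set:: take i.+1 s]) F (nth set0 s i)].
Proof.
have [n] := ubnP #|T :\: X|; elim: n X => // n IHn X leTX sEX sXT perc reachX.
have [sTX|nTX] := boolP (T \subset X).
  suff <- : X = T by [].
  by apply/eqP; rewrite eqEsubset sXT.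
have [e [eT eX eC]] : exists e, [/\ e \in T, e \notin X &
    has_copy_through (e |: X) F e].
  apply: contrapT => noe; case/negP: nTX; apply/subsetP => e /perc.
  elim=> [{}e eE|f e0 finj e0F fe0 _ IH]; first exact: (subsetP sEX).
  apply: contrapT => /negP fe0X; apply: noe; exists (f @: e0); split=> //.
  exists f; last by exists e0.
  split=> // e' e'F; have [-> |e'e0] := eqVneq e' e0; first exact: setU11.
  by rewrite setU1r // IH.
apply: (IHn (e |: X)) => //.
- rewrite -ltnS (leq_trans _ leTX) // ltnS; apply: proper_card.
  apply/properP; split; first by rewrite setDS // subsetU1.
  by exists e; rewrite !inE ?eqxx ?eT ?eX.
- by rewrite (subset_trans sEX) // subsetU1.
- by rewrite subUset sub1set eT.
have [s [us sX sC]] := reachX.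
have es : e \notin s.
  have : e \notin [set:: s] by rewrite sX !inE (negPf eX) andbF.
  by rewrite inE.
exists (rcons s e); split; first by rewrite rcons_uniq es.
  apply/setP => x; move/setP/(_ x): sX; rewrite !inE mem_rcons inE => ->.
  have [-> /=|//] := eqVneq x e; apply/esym.
  by rewrite andbT; apply: contra eX => /(subsetP sEX).
move=> i; rewrite size_rcons ltnS leq_eqVlt => /predU1P[->|lti].
  rewrite nth_rcons ltnn eqxx take_oversize ?size_rcons //.
  case: eC => f [finj fE] e'; exists f => //; split=> // e1 /fE.
  move/setP: sX => /(_ (f @: e1)); rewrite !inE mem_rcons inE => ->.
  by case: (_ == e); case: (_ \in E).
rewrite nth_rcons lti -cats1 takel_cat //; exact: sC.
Qed.

(** A percolating set may contain copies of [F], whereas a weakly saturated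
    graph may not.  Removing an edge of such a copy keeps the set percolating,
    since that edge is activated at once, so a smaller set is available. *)
Lemma wsat_le_percolating G E : 0 < #|edges F| -> E \subset edges G ->
  percolates (edges G) E -> wsat G F <= #|E|.
Proof.
move=> F0; have [n] := ubnP #|E|; elim: n E => // n IHn E leE sEG perc.
have [[f [finj fE]]|nocopy] := pselect (has_copy E F).
  have /card_gt0P[e0 e0F] := F0.
  have ltE : #|E :\ (f @: e0)| < #|E|.
    by rewrite (cardsD1 (f @: e0) E) fE.
  apply: leq_trans (ltnW ltE); apply: IHn.
  - exact: leq_trans ltE _.
  - exact: subset_trans (subsetDl _ _) sEG.
  move=> e /perc; apply: activated_trans => e' e'E.
  have [->|e'e0] := eqVneq e' (f @: e0); last first.
    by apply: activated_init; rewrite !inE e'e0.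
  apply: activated_copy => //; first exact/(subsetP sEG)/fE.
  move=> e1 e1F e10; apply: activated_init; rewrite !inE fE // andbT.
  by apply: contra e10 => /eqP/(imset_inj finj)->.
have sEp : E \subset pairs V by apply: subset_trans sEG (valP G).
pose H := Graph sEp.
have wsH : weakly_saturated G F H.
  split=> //; apply: (@percolates_ordering _ _ E) => //.
  by exists [::]; split=> //; rewrite setDv; apply/setP => x; rewrite !inE.
rewrite /wsat -minEnat.
rewrite -leEnat; apply: (@bigmin_le_cond _ _ _ _ H); exact/asboolP.
Qed.

Lemma wsat_attained G : exists H,
  [/\ edges H \subset edges G, percolates (edges G) (edges H) &
      #|edges H| = wsat G F].
Proof.
rewrite /wsat; elim/big_ind: _.
- by exists G; split=> // e eG; apply: activated_init.
- by move=> x y Hx Hy; rewrite /minn; case: ifP.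
move=> H /asboolP[sHG _ [s [us sE sC]]]; exists H; split=> // e eG.
have key i : i <= size s -> forall e, e \in edges H :|: [set:: take i s] ->
    activated (edges G) (edges H) e.
  elim: i => [_ e'|i IH lti e'].
    by rewrite take0 !inE orbF => /activated_init; apply.
  rewrite (take_nth set0) // !inE mem_rcons inE orbCA => /predU1P[->|e'i].
    have [f [finj fE] [e0 e0F fe0]] := sC i lti.
    have sG : nth set0 s i \in edges G.
      have : nth set0 s i \in [set:: s] by rewrite inE mem_nth.
      by rewrite sE inE => /andP[].
    rewrite -fe0; apply: activated_copy => // [|e1 e1F e10].
      by rewrite fe0.
    apply: (IH (ltnW lti)); have := fE _ e1F.
    rewrite (take_nth set0) // !inE mem_rcons inE orbCA => /predU1P[eq1|//].
    by move: e10; rewrite -fe0 in eq1; rewrite (imset_inj finj eq1) eqxx.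
  by apply: (IH (ltnW lti)); rewrite !inE.
by apply: (key (size s)) => //; rewrite take_size sE !inE eG andbT orbN.
Qed.

(** * Attaching a vertex by a vertex of minimum degree of the pattern *)

Definition neighbours (u : U) : {set U} := [set w | [set u; w] \in edges F].

Lemma edge_neq (W : finType) (G : graph W) x y :
  [set x; y] \in edges G -> x != y.
Proof.
by move=> /(subsetP (valP G)); rewrite inE cards2; case: (x != y).
Qed.

Lemma edge_pair (W : finType) (G : graph W) e :
  e \in edges G -> exists x y, x != y /\ e = [set x; y].
Proof. by move=> /(subsetP (valP G)); rewrite inE => /cards2P. Qed.

Lemma card_neighbours u : #|neighbours u| = degree F u.
Proof.
rewrite /degree -[LHS](@card_in_imset _ _ (fun w => [set u; w])).
  apply: eq_card => e; apply/imsetP/idP => [[w]|].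
    by rewrite !inE => uwF ->; rewrite uwF set21.
  rewrite inE => /andP[eF ue].
  have [x [y [_ eE]]] := edge_pair eF.
  move: eF ue; rewrite eE !inE => eF /orP[]/eqP uE.
    by exists y; rewrite ?inE uE.
  by exists x; rewrite ?inE uE setUC.
move=> w w'; rewrite !inE => uw uw' /setP/(_ w).
rewrite !inE eqxx orbT => /esym/orP[/eqP wu|/eqP//].
by move: (edge_neq uw); rewrite wu eqxx.
Qed.

Lemma degree_lt_card u : degree F u < #|U|.
Proof.
rewrite -card_neighbours -cardsT; apply: proper_card.
apply/properP; split; first exact: subsetT.
exists u; rewrite !inE //.
by apply/negP => /edge_neq; rewrite eqxx.
Qed.

Lemma min_degree_attained : 0 < min_degree F ->
  exists u, degree F u = min_degree F.
Proof.
have [u _ _|U0] := pickP U; last first.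
  by rewrite /min_degree big_pred0 // (eq_card0 U0).
rewrite /min_degree -minEnat.
have := @eq_bigmin _ _ U #|U| u xpredT (degree F) isT.
case=> [v _|v _ ->]; first exact/ltnW/degree_lt_card.
by exists v.
Qed.

Lemma min_degree_edge : 0 < min_degree F -> 0 < #|edges F|.
Proof.
move=> dF; have [u du] := min_degree_attained dF.
rewrite -du in dF; apply: leq_trans dF _; rewrite /degree.
by apply/subset_leq_card/subsetP => e; rewrite inE => /andP[].
Qed.

Lemma min_degree_le_card : 0 < min_degree F -> min_degree F <= #|U|.
Proof.
by move=> dF; have [u <-] := min_degree_attained dF; apply/ltnW/degree_lt_card.
Qed.

(** The copy of [F] sends a vertex [u0] of minimum degree to [v], one of its
    neighbours to [w], its other neighbours into [Q] and all other vertices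
    into the rest of [B].  The only edge of the copy not yet known to be
    activated is then [vw]. *)
Lemma activated_attach T E v w (B Q : {set V}) :
  0 < min_degree F -> #|U| <= #|B|.+1 -> v \notin B -> w \in B ->
  Q \subset B :\ w -> min_degree F <= #|Q|.+1 ->
  (forall x y, x \in B -> y \in B -> x != y -> activated T E [set x; y]) ->
  (forall q, q \in Q -> activated T E [set v; q]) ->
  [set v; w] \in T -> activated T E [set v; w].
Proof.
move=> dF UB vB wB sQ dQ actB actQ vwT.
have [u0 du0] := min_degree_attained dF.
have nb0 := card_neighbours u0; rewrite du0 in nb0.
have /card_gt0P[u1 u1N] : 0 < #|neighbours u0| by rewrite nb0.
have u10 : u1 != u0.
  by move: u1N; rewrite inE => /edge_neq; rewrite eq_sym.
have u0N : u0 \notin neighbours u0.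
  by rewrite inE; apply/negP => /edge_neq; rewrite eqxx.
pose N1 := neighbours u0 :\ u1.
(* The injection matches these two duplicate-free lists position by
   position; [vs] may be longer than [us]. *)
pose us := [:: u0, u1 & enum N1 ++ enum (~: (u0 |: neighbours u0))].
pose vs := [:: v, w & enum Q ++ enum (B :\ w :\: Q)].
have usT u : u \in us.
  rewrite /us !inE mem_cat !mem_enum !inE.
  by case: (u == u0); case: (u == u1); case: (_ \in edges F).
have cN1 : #|N1|.+1 = min_degree F.
  by rewrite -nb0 [in RHS](cardsD1 u1) u1N.
have sz_us : size us = #|U|.
  rewrite /us /= size_cat -!cardE.
  have := cardsC (u0 |: neighbours u0); rewrite cardsU1 u0N nb0 -cN1.
  by move<-; rewrite !addSn.
have sz_vs : size vs = #|B|.+1.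
  rewrite /vs /= size_cat -!cardE cardsD (setIidPr sQ) subnKC ?subset_leq_card //.
  by rewrite (cardsD1 w B) wB.
have uniq_vs : uniq vs.
  have vw : v != w by apply: contraNneq vB => ->.
  rewrite /vs /= cat_uniq !enum_uniq /= !inE !mem_cat !mem_enum !inE eqxx.
  rewrite (negPf vw) (negPf vB) !andbF !andbT /= orbF.
  have vQ : v \notin Q by apply: contra vB => /(subsetP sQ); rewrite inE => /andP[].
  have wQ : w \notin Q by apply/negP => /(subsetP sQ); rewrite !inE eqxx.
  rewrite (negPf vQ) (negPf wQ) /=; apply/hasPn => x; rewrite !mem_enum !inE.
  by case/andP.
have uniq_us : uniq us.
  rewrite (@eq_uniq _ _ (enum U)) ?enum_uniq //.
  - by rewrite sz_us -cardE.
  - by move=> u; rewrite usT mem_enum.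
pose f u := nth v vs (index u us).
have idx u : index u us < size vs.
  by rewrite sz_vs (leq_trans _ UB) // -sz_us index_mem.
have f_vs u : f u \in vs by apply: mem_nth.
have finj : injective f.
  move=> x y /eqP; rewrite /f nth_uniq // => /eqP.
  by move/(congr1 (nth u0 us)); rewrite !nth_index.
have f0 : f u0 = v by rewrite /f /us /= eqxx.
have f1 : f u1 = w by rewrite /f /us /= eqxx eq_sym (negPf u10).
have fN u : u \in neighbours u0 -> u != u1 -> f u \in Q.
  move=> uN uu1; have uu0 : u != u0 by apply: contraNneq u0N => eu; rewrite -{1}eu.
  rewrite /f /us /= ![_ == u]eq_sym (negPf uu0) (negPf uu1).
  have uN1 : u \in enum N1 by rewrite mem_enum !inE uu1; rewrite inE in uN.
  rewrite index_cat uN1 /= nth_cat -cardE.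
  have ltQ : index u (enum N1) < #|Q|.
    by rewrite -ltnS; apply: leq_trans dQ; rewrite -cN1 ltnS cardE index_mem.
  by rewrite ltQ -mem_enum mem_nth // -cardE.
have fB u : u != u0 -> f u \in B.
  move=> uu0; have := f_vs u; rewrite !inE mem_cat !mem_enum !inE.
  case/orP => [/eqP fv|]; first by move: uu0; rewrite -(inj_eq finj) f0 fv eqxx.
  case/orP => [/eqP->//|/orP[/(subsetP sQ)|]].
    by rewrite inE => /andP[].
  by case/and3P.
have fe e : e \in edges F -> e != [set u0; u1] -> activated T E (f @: e).
  move=> eF ne; have [x [y [xy eE]]] := edge_pair eF.
  rewrite eE imsetU1 imset_set1; rewrite eE in eF ne.
  have actv z : [set u0; z] \in edges F -> [set u0; z] != [set u0; u1] ->
      activated T E [set f u0; f z].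
    move=> zN nz; rewrite f0; apply: actQ; apply: fN; first by rewrite inE.
    by apply: contraNneq nz => ->.
  have [x0|x0] := eqVneq x u0; first by rewrite x0 in eF ne *; exact: actv.
  have [y0|y0] := eqVneq y u0.
    by rewrite y0 setUC in eF ne *; rewrite setUC; apply: actv.
  by apply: actB; rewrite ?fB // (inj_eq finj).
have -> : [set v; w] = f @: [set u0; u1] by rewrite imsetU1 imset_set1 f0 f1.
apply: activated_copy fe => //; first by rewrite inE in u1N.
by rewrite imsetU1 imset_set1 f0 f1.
Qed.
End Activation.

Lemma activated_map (V W U : finType) (F : graph U) (g : V -> W)
    (T E : {set {set V}}) (T' : {set {set W}}) e :
  injective g -> (forall e', e' \in T -> g @: e' \in T') ->
  activated F T E e ->
  activated F T' [set g @: (e' : {set V}) | e' in E] (g @: e).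
Proof.
move=> ginj gT; elim=> [{}e eE|f e0 finj e0F fe0 _ IH].
  by apply: activated_init; apply: imset_f.
rewrite -imset_comp; apply: activated_copy => //.
- exact: inj_comp.
- by rewrite imset_comp; apply: gT.
- by move=> e1 e1F e10; rewrite imset_comp; apply: IH.
Qed.

(** * Extendable graphs *)

Section Extendable.
Local Open Scope nat_scope.
Local Open Scope set_scope.
Variables (V U : finType) (F : graph U).
Implicit Types (T E : {set {set V}}) (G : graph V) (K Q S : {set V}).

Definition clique G Q :=
  forall x y, x \in Q -> y \in Q -> x != y -> [set x; y] \in edges G.

Definition joined G Q S :=
  forall q s, q \in Q -> s \in S -> [set q; s] \in edges G.

Lemma joined_notin G Q S q : joined G Q S -> q \in Q -> q \notin S.
Proof.
by move=> QS qQ; apply/negP => /(QS _ _ qQ)/edge_neq; rewrite eqxx.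
Qed.

Lemma joinedW G Q S S' : S' \subset S -> joined G Q S -> joined G Q S'.
Proof. by move=> /subsetP sS QS q s qQ /sS; apply: QS. Qed.

Lemma cliqueU G Q S : clique G Q -> clique G S -> joined G Q S ->
  clique G (Q :|: S).
Proof.
move=> cQ cS QS x y; rewrite !inE => /orP[xQ|xS] /orP[yQ|yS] xy.
- exact: cQ.
- exact: QS.
- by rewrite setUC; apply: QS.
- exact: cS.
Qed.

Lemma clique1 G x : clique G [set x].
Proof. by move=> y z /set1P-> /set1P->; rewrite eqxx. Qed.

Definition common_nbr S E w := [forall s in S, [set s; w] \in E].

Definition extendable M G :=
  [forall S : {set V}, (#|S| <= M) ==> [exists w, common_nbr S (edges G) w]].

Lemma common_clique M G S j : extendable M G -> #|S| + j <= M ->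
  exists Q, [/\ #|Q| = j, clique G Q & joined G Q S].
Proof.
move=> /forallP ext; elim: j => [_|j IHj leM].
  exists set0; split; [by rewrite cards0| |].
    by move=> x y; rewrite inE.
  by move=> x y; rewrite inE.
have [Q [cQ clQ QS]] : exists Q, [/\ #|Q| = j, clique G Q & joined G Q S].
  by apply: IHj; lia.
have /implyP/(_ _)/existsP[|w /forallP wP] := ext (S :|: Q).
  by apply: leq_trans (leq_card_setU _ _) _; lia.
have {}wP s : s \in S :|: Q -> [set w; s] \in edges G.
  by move=> sSQ; rewrite setUC; have := wP s; rewrite sSQ.
have wQ : w \notin Q.
  by apply/negP => wQ; have /edge_neq : [set w; w] \in edges G;
    rewrite ?eqxx // wP // inE wQ orbT.
exists (w |: Q); split; first by rewrite cardsU1 wQ cQ.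
- apply: cliqueU => //; first exact: clique1.
  by move=> x q /set1P-> qQ; apply: wP; rewrite inE qQ orbT.
- move=> x s /setU1P[->|xQ] sS; last exact: QS.
  by apply: wP; rewrite inE sS.
Qed.

(** This form of the attaching move is symmetric in [x] and [y]: both are
    linked to a large activated clique [Q], and [B] is [y |: Q]. *)
Lemma activated_over_clique T E x y Q :
  0 < min_degree F -> #|U| <= #|Q| -> x != y -> x \notin Q -> y \notin Q ->
  (forall q q', q \in Q -> q' \in Q -> q != q' ->
     activated F T E [set q; q']) ->
  (forall q, q \in Q -> activated F T E [set x; q]) ->
  (forall q, q \in Q -> activated F T E [set y; q]) ->
  [set x; y] \in T -> activated F T E [set x; y].
Proof.
move=> dF UQ xy xQ yQ actQ actx acty.
apply: (@activated_attach _ _ _ _ _ _ _ (y |: Q) Q) => //.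
- by rewrite cardsU1 yQ; lia.
- by rewrite !inE (negPf xy).
- exact: setU11.
- apply/subsetP => q qQ; rewrite !inE qQ orbT andbT.
  by apply: contraNneq yQ => <-.
- by apply: leq_trans (min_degree_le_card dF) _; lia.
move=> a b /setU1P[->|aQ] /setU1P[->|bQ]; rewrite ?eqxx // => ab.
- exact: acty.
- by rewrite setUC; apply: acty.
- exact: actQ.
Qed.

(** Every percolating set of [G] percolates in the complete graph, because each
    pair absent from [G] is activated over a clique of common neighbours. *)
Lemma wsat_complete_le M G : 0 < min_degree F -> #|U| + 2 <= M ->
  extendable M G -> wsat (complete V) F <= wsat G F.
Proof.
move=> dF UM ext; have [H [sHG perc <-]] := wsat_attained F G.
have sG : edges G \subset edges (complete V) := valP G.
apply: wsat_le_percolating; first exact: min_degree_edge.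
- exact: subset_trans sHG sG.
have actG e : e \in edges G -> activated F (edges (complete V)) (edges H) e.
  by move=> /perc; apply: activated_sub.
move=> e eP; have [x [y [xy eE]]] := edge_pair eP.
rewrite eE in eP *.
have [|Q [cQ clQ Qxy]] := common_clique (S := [set x; y]) (j := #|U|) ext.
  by rewrite cards2 xy; lia.
have Qx q : q \in Q -> [set x; q] \in edges G.
  by move=> qQ; rewrite setUC; apply: Qxy => //; rewrite set21.
have Qy q : q \in Q -> [set y; q] \in edges G.
  by move=> qQ; rewrite setUC; apply: Qxy => //; rewrite set22.
apply: (@activated_over_clique _ _ _ _ Q) => //; first by rewrite cQ.
- by apply/negP => /Qx/edge_neq; rewrite eqxx.
- by apply/negP => /Qy/edge_neq; rewrite eqxx.
- by move=> q q' qQ q'Q qq'; apply/actG/clQ.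
- by move=> q /Qx/actG.
- by move=> q /Qy/actG.
Qed.

Lemma exists_subset_card K d : d <= #|K| ->
  exists2 Q : {set V}, Q \subset K & #|Q| = d.
Proof.
move=> dK; exists [set:: take d (enum K)].
  by apply/subsetP => x; rewrite inE => /mem_take; rewrite mem_enum.
have us : uniq (take d (enum K)) by rewrite take_uniq ?enum_uniq.
by rewrite cardsE (card_uniqP us) size_take_min -cardE; apply/minn_idPl.
Qed.

Lemma leq_card_bigcup (I : finType) (P : {set I}) (A : I -> {set {set V}}) d :
  (forall i, i \in P -> #|A i| <= d) -> #|\bigcup_(i in P) A i| <= d * #|P|.
Proof.
move=> Ad; rewrite mulnC -sum_nat_const.
apply: (big_ind2 (fun (X : {set {set V}}) m => #|X| <= m)) => //.
  by rewrite cards0.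
by move=> X m Y n Xm Yn; apply: leq_trans (leq_card_setU _ _) (leq_add Xm Yn).
Qed.

(** The order of activation is: the edges between [C] and [K]; those inside
    [A := K :|: C]; the edges from an outside vertex [v] to the vertices of [A]
    joined to all of [Q v]; all edges from [v] to [A]; the edges with
    both ends outside [A].
    The bound on [M] covers the largest set that has to be extended, namely
    [K], two further vertices and [Q v], extended by a clique of size
    [#|U|]. *)
Lemma percolates_from_clique M G K (Q : V -> {set V}) E :
  0 < min_degree F -> #|U| <= #|K| -> #|K| + 2 * #|U| + 2 <= M ->
  extendable M G ->
  let C := [set v | [forall k in K, [set v; k] \in edges G]] in
  (forall x y, x \in K -> y \in K -> x != y ->
     activated F (edges G) E [set x; y]) ->
  (forall v, v \notin K -> #|Q v| = (min_degree F).-1 /\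
     forall q, q \in Q v -> [set v; q] \in E) ->
  (forall v, v \in C -> Q v \subset K) ->
  (forall v, v \notin K -> v \notin C -> clique G (Q v) /\ Q v \subset C) ->
  percolates F (edges G) E.
Proof.
move=> dF UK KM ext C actK QP QC QnC.
have dU := min_degree_le_card dF.
have dM v : v \notin K -> #|Q v| = (min_degree F).-1 by case/QP.
have actQ v q : v \notin K -> q \in Q v -> activated F (edges G) E [set v; q].
  by move=> /QP[_ QE] /QE; apply: activated_init.
have CK v k : v \in C -> k \in K -> [set v; k] \in edges G.
  by rewrite inE => /forallP/(_ k)/implyP.
have joinC Z S : K \subset S -> joined G Z S -> Z \subset C.
  move=> KS ZS; apply/subsetP => z zZ; rewrite inE; apply/forallP => k.
  by apply/implyP => /(subsetP KS); apply: ZS.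
have CnK v : v \in C -> v \notin K.
  by move=> vC; apply/negP => /(CK _ _ vC)/edge_neq; rewrite eqxx.
have actCK v k : v \in C -> k \in K -> activated F (edges G) E [set v; k].
  move=> vC kK; have vK := CnK _ vC.
  have [kQ|kQ] := boolP (k \in Q v); first exact: actQ.
  apply: (@activated_attach _ _ _ _ _ _ _ K (Q v)) => //.
  - exact: leqW.
  - apply/subsetP => q qQ; rewrite !inE (subsetP (QC _ vC)) // andbT.
    by apply: contraNneq kQ => <-.
  - by rewrite dM // prednK.
  - by move=> q; apply: actQ.
  - exact: CK.
pose A := K :|: C.
have actA x y : x \in A -> y \in A -> [set x; y] \in edges G ->
    activated F (edges G) E [set x; y].
  move=> /setUP[xK|xC] /setUP[yK|yC] xyG; have xy := edge_neq xyG.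
  - exact: actK.
  - by rewrite setUC; apply: actCK.
  - exact: actCK.
  - apply: (@activated_over_clique _ _ _ _ K) => //; try exact: CnK.
    + by move=> q; apply: actCK.
    + by move=> q; apply: actCK.
have CA : C \subset A by apply: subsetUr.
have outA v : v \notin A -> v \notin K /\ v \notin C.
  by rewrite in_setU negb_or => /andP[].
(* The clique [Q v] with [w] extends, inside [C], to a clique large enough to
   hold the copy. *)
have act1 v w : v \notin A -> w \in A -> [set v; w] \in edges G ->
    joined G [set w] (Q v) -> activated F (edges G) E [set v; w].
  move=> vA wA vwG wQ; have [vK vC] := outA v vA.
  have [clQ QvC] := QnC v vK vC.
  pose P := w |: Q v.
  have clP : clique G P by apply: cliqueU => //; apply: clique1.
  have [|Z [cZ clZ ZS]] := common_clique (S := K :|: P) (j := #|U|) ext.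
    have [cKP _] := leq_card_setU K P; have [+ _] := leq_card_setU [set w] (Q v).
    by rewrite -/P cards1 dM //; lia.
  have ZC : Z \subset C by apply: joinC ZS; apply: subsetUl.
  have ZP : joined G Z P by apply: joinedW ZS; apply: subsetUr.
  have sBA : Z :|: P \subset A.
    by rewrite !subUset sub1set wA (subset_trans ZC CA) (subset_trans QvC CA).
  have clB : clique G (Z :|: P) by apply: cliqueU.
  have nwQ : w \notin Q v by apply: (joined_notin wQ); rewrite inE.
  apply: (@activated_attach _ _ _ _ _ _ _ (Z :|: P) (Q v)) => //.
  - by apply: leqW; rewrite -cZ; apply/subset_leq_card/subsetUl.
  - by apply: contra vA => /(subsetP sBA).
  - by rewrite !inE eqxx orbT.
  - apply/subsetP => q qQ; rewrite !inE qQ !orbT andbT.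
    by apply: contraNneq nwQ => <-.
  - by rewrite dM // prednK.
  - move=> x y xB yB xy; apply: actA; try exact: (subsetP sBA).
    exact: clB.
  - by move=> q; apply: actQ.
(* For a general [w], a clique of common neighbours of [v], [w] and [Q v] inside
   [C] is reached by the previous step, and serves in place of [Q v]. *)
have act2 v w : v \notin A -> w \in A -> [set v; w] \in edges G ->
    activated F (edges G) E [set v; w].
  move=> vA wA vwG; have [vK vC] := outA v vA; have [clQ QvC] := QnC v vK vC.
  pose P := [set v; w] :|: Q v.
  have [|Z [cZ clZ ZS]] := common_clique (S := K :|: P) (j := #|U|) ext.
    have [cKP _] := leq_card_setU K P; have [+ _] := leq_card_setU [set v; w] (Q v).
    by rewrite -/P cards2 (edge_neq vwG) dM //; lia.
  have ZC : Z \subset C by apply: joinC ZS; apply: subsetUl.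
  have ZA := subset_trans ZC CA.
  have ZP : joined G Z P by apply: joinedW ZS; apply: subsetUr.
  have vP : v \in P by rewrite !inE eqxx.
  have wP : w \in P by rewrite !inE eqxx orbT.
  apply: (@activated_over_clique _ _ _ _ Z) => //.
  - by rewrite cZ.
  - exact: edge_neq vwG.
  - by apply: contraL vP; apply: (joined_notin ZP).
  - by apply: contraL wP; apply: (joined_notin ZP).
  - by move=> q q' qZ q'Z qq'; apply: actA; rewrite ?(subsetP ZA) //; apply: clZ.
  - move=> q qZ; apply: act1 => //; first exact: (subsetP ZA).
      by rewrite setUC; apply: ZP.
    by move=> _ s /set1P-> sQ; apply: ZP => //; rewrite inE sQ orbT.
  - move=> q qZ; apply: actA => //; first exact: (subsetP ZA).
    by rewrite setUC; apply: ZP.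
move=> e eG; have [x [y [xy eE]]] := edge_pair eG.
rewrite eE in eG *.
have [xA|xA] := boolP (x \in A); have [yA|yA] := boolP (y \in A).
- exact: actA.
- by rewrite setUC; apply: act2; rewrite // setUC.
- exact: act2.
have [|Z [cZ clZ ZS]] := common_clique (S := K :|: [set x; y]) (j := #|U|) ext.
  by have [+ _] := leq_card_setU K [set x; y]; rewrite cards2 xy; lia.
have ZC : Z \subset C by apply: joinC ZS; apply: subsetUl.
have ZA := subset_trans ZC CA.
have ZP : joined G Z [set x; y] by apply: joinedW ZS; apply: subsetUr.
have actZ v : v \notin A -> v \in [set x; y] ->
    forall q, q \in Z -> activated F (edges G) E [set v; q].
  move=> vA vxy q qZ; apply: act2 => //; first exact: (subsetP ZA).
  by rewrite setUC; apply: ZP.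
apply: (@activated_over_clique _ _ _ _ Z) => //.
- by rewrite cZ.
- by apply: contra xA => /(subsetP ZA).
- by apply: contra yA => /(subsetP ZA).
- by move=> q q' qZ q'Z qq'; apply: actA; rewrite ?(subsetP ZA) //; apply: clZ.
- by apply: actZ; rewrite // set21.
- by apply: actZ; rewrite // set22.
Qed.

(** Each vertex outside [K] costs exactly one edge less than the minimum degree
    of [F]; the clique [K] costs its weak saturation number. *)
Lemma wsat_le_extendable M N G :
  0 < min_degree F -> #|U| <= N -> N + 2 * #|U| + 2 <= M -> extendable M G ->
  wsat G F <= wsatK N F + (min_degree F).-1 * (#|V| - N).
Proof.
move=> dF UN NM ext; have dU := min_degree_le_card dF.
have [|K [cK clK _]] := common_clique (S := set0) (j := N) ext.
  by rewrite cards0; lia.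
subst N; have [H [_ percH cH]] := wsat_attained F (complete 'I_#|K|); rewrite /wsatK -cH.
pose g (i : 'I_#|K|) : V := enum_val i.
have ginj : injective g := enum_val_inj.
pose E0 := [set g @: (e : {set 'I_#|K|}) | e in edges H].
have gK i : g i \in K by apply: enum_valP.
have gG e : e \in pairs 'I_#|K| -> g @: e \in edges G.
  rewrite inE => /cards2P[i [j [ij ->]]]; rewrite imsetU1 imset_set1.
  by apply: clK; rewrite ?(inj_eq ginj).
have sHG e : e \in edges H -> g @: e \in edges G.
  by move=> /(subsetP (valP H)); apply: gG.
pose C := [set v | [forall k in K, [set v; k] \in edges G]].
have /choice[Q QP] v : exists Q : {set V}, v \notin K ->
    [/\ #|Q| = (min_degree F).-1,
        forall q, q \in Q -> [set v; q] \in edges G,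
        v \in C -> Q \subset K &
        v \notin C -> clique G Q /\ Q \subset C].
  have [vC|vC] := boolP (v \in C).
    have [|Q QK cQ] := @exists_subset_card K (min_degree F).-1; first lia.
    exists Q; split=> // q /(subsetP QK) qK.
    by move: vC; rewrite inE => /forallP/(_ q)/implyP/(_ qK).
  have [|Q [cQ clQ QS]] := common_clique (S := v |: K) (j := (min_degree F).-1) ext.
    by rewrite cardsU1; lia.
  exists Q; split=> // [q qQ|_].
    by rewrite setUC; apply: QS => //; apply: setU11.
  split=> //; apply/subsetP => z zQ; rewrite inE; apply/forallP => k.
  by apply/implyP => kK; apply: QS => //; apply: setU1r.
pose E := E0 :|: \bigcup_(v in ~: K) [set [set v; q] | q in Q v].
have cE : #|E| <= #|edges H| + (min_degree F).-1 * (#|V| - #|K|).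
  apply: leq_trans (leq_card_setU _ _) _; apply: leq_add.
    exact: leq_imset_card.
  have -> : #|V| - #|K| = #|~: K| by rewrite -(cardsC K) addKn.
  apply: leq_card_bigcup => v; rewrite inE => /QP[<- _ _ _].
  exact: leq_imset_card.
apply: leq_trans cE; apply: wsat_le_percolating; first exact: min_degree_edge.
  rewrite subUset; apply/andP; split.
    by apply/subsetP => _ /imsetP[e eH ->]; apply: sHG.
  apply/bigcupsP => v; rewrite inE => /QP[_ vQ _ _].
  by apply/subsetP => _ /imsetP[q qQ ->]; apply: vQ.
apply: (@percolates_from_clique M G K Q) => //.
- move=> x y xK yK xy.
  have [i xE] : exists i, x = g i.
    by exists (enum_rank_in xK x); rewrite /g enum_rankK_in.
  have [j yE] : exists i, y = g i.
    by exists (enum_rank_in xK y); rewrite /g enum_rankK_in.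
  rewrite xE yE (inj_eq ginj) in xy *.
  have -> : [set g i; g j] = g @: [set i; j] by rewrite imsetU1 imset_set1.
  apply: (@activated_trans _ _ _ _ E0) => [e eE0|].
    by apply: activated_init; rewrite inE eE0.
  apply: (activated_map (T := pairs 'I_#|K|)) => //.
  by apply: percH; rewrite inE cards2 xy.
- move=> v vK; have [cQ _ _ _] := QP v vK; split=> // q qQ.
  rewrite inE; apply/orP; right.
  by apply/bigcupP; exists v; rewrite ?inE //; apply: imset_f.
- move=> v vC; have vK : v \notin K.
    apply/negP => vK; move: vC; rewrite inE => /forallP/(_ v)/implyP/(_ vK).
    by move=> /edge_neq; rewrite eqxx.
  by have [_ _ QK _] := QP v vK; apply: QK.
- by move=> v vK vC; have [_ _ _ QC] := QP v vK; apply: QC.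
Qed.
End Extendable.

(** * The weak saturation number of extendable graphs *)

Section Stabilization.
Local Open Scope nat_scope.
Variables (U : finType) (F : graph U).

Lemma extendable_complete M n : M < n -> extendable M (complete 'I_n).
Proof.
move=> Mn; apply/forallP => S; apply/implyP => SM.
have /set0Pn[w] : ~: S != set0.
  rewrite -card_gt0; have := cardsC S; rewrite card_ord; lia.
rewrite inE => wS; apply/existsP; exists w; apply/forallP => s.
apply/implyP => sS; rewrite inE cards2.
by have -> : s != w by apply: contraNneq wS => <-.
Qed.

(** [N] is chosen to minimize the excess of [wsatK N F] over
    [(min_degree F).-1 * N] among all [N >= #|U|].  Adding [D] keeps the excess
    a natural number. *)
Lemma wsatK_eventually_linear :
  0 < min_degree F ->
  (exists D, forall n, (min_degree F).-1 * n <= wsatK n F + D) ->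
  exists2 N, #|U| <= N & forall n, N + 2 * #|U| + 2 < n ->
    wsatK n F = wsatK N F + (min_degree F).-1 * (n - N).
Proof.
move=> dF [D hD]; set d := _.-1 in hD *.
pose excess m := `[< exists2 N, #|U| <= N & wsatK N F + D = d * N + m >].
have exm : exists m, excess m.
  exists (wsatK #|U| F + D - d * #|U|); apply/asboolP; exists #|U| => //.
  by rewrite subnKC.
have [m /asboolP[N UN defm] minm] := ex_minnP exm.
exists N => // n Nn; apply/eqP; rewrite eqn_leq; apply/andP; split.
  rewrite -[n in d * (n - N)]card_ord.
  apply: (@wsat_le_extendable 'I_n U F (N + 2 * #|U| + 2)) => //.
  exact: extendable_complete.
have /minm : excess (wsatK n F + D - d * n).
  apply/asboolP; exists n; first lia.
  by rewrite subnKC.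
have := hD n; rewrite mulnBr; have : d * N <= d * n by rewrite leq_mul2l; lia.
lia.
Qed.

Lemma wsat_extendable N n (G : graph 'I_n) :
  0 < min_degree F -> #|U| <= N -> N + 2 * #|U| + 2 < n ->
  wsatK n F = wsatK N F + (min_degree F).-1 * (n - N) ->
  extendable (N + 2 * #|U| + 2) G -> wsat G F = wsatK n F.
Proof.
move=> dF UN Nn Kn ext; apply/eqP; rewrite eqn_leq; apply/andP; split.
  rewrite Kn -[n in _ * (n - N)]card_ord.
  exact: wsat_le_extendable ext.
apply: wsat_complete_le ext => //; lia.
Qed.
End Stabilization.

(** * The random graph is extendable *)

Section RandomGraph.
Local Open Scope ring_scope.
Variables (R : realType) (n : nat) (p : R).
Implicit Types (E X : {set {set 'I_n}}) (S J : {set 'I_n}).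

Definition weight E : R :=
  \prod_(e in pairs 'I_n) (if e \in E then p else 1 - p).

Lemma sum_graphs (P : pred {set {set 'I_n}}) (f : {set {set 'I_n}} -> R) :
  \sum_(G : graph 'I_n | P (edges G)) f (edges G) =
  \sum_(E : {set {set 'I_n}} | (E \subset pairs 'I_n) && P E) f E.
Proof.
rewrite [RHS](reindex_omap (@edges 'I_n) insub) => [|E /andP[sE _]]; last first.
  by rewrite insubT.
apply: eq_bigl => G; rewrite (valP G) /=.
by rewrite -[edges G]/(val G) valK eqxx andbT.
Qed.

(** The probability that the random graph contains [E]: the product over all
    vertex sets [e] of [f e + g e] expands into the weights of the graphs that
    contain [E], where the choice [g e = 0] on [E] forces [e] to be present. *)
Lemma sum_weight_supset E : E \subset pairs 'I_n ->
  \sum_(G : graph 'I_n | E \subset edges G) weight (edges G) = p ^+ #|E|.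
Proof.
move=> sE; rewrite (sum_graphs (fun X => E \subset X)).
pose f (e : {set 'I_n}) : R := if e \in pairs 'I_n then p else 0.
pose g (e : {set 'I_n}) : R :=
  if e \in pairs 'I_n then (if e \in E then 0 else 1 - p) else 1.
transitivity (\prod_e (f e + g e)); last first.
  rewrite -prodr_const [RHS]big_mkcond; apply: eq_bigr => e _; rewrite /f /g.
  have [eE|eE] := boolP (e \in E); first by rewrite (subsetP sE) // addr0.
  by case: ifP => _; rewrite ?add0r // addrC subrK.
rewrite bigA_distr [RHS](bigID (fun X => (X \subset pairs 'I_n) && (E \subset X))).
rewrite /= [X in _ + X]big1 ?addr0 => [|X]; last first.
  rewrite negb_and => /orP[] /subsetPn[e eX eN].
    by rewrite (bigD1 e) //= eX /f (negPf eN) mul0r.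
  by rewrite (bigD1 e) //= (negPf eN) /g eX (subsetP sE) // mul0r.
apply: eq_bigr => X /andP[sX sEX]; rewrite /weight big_mkcond; apply: eq_bigr => e _.
rewrite /f /g; have [eP|eP] := boolP (e \in pairs 'I_n).
  case: ifP => // eX; case: ifP => // eE.
  by rewrite (subsetP sEX _ eE) in eX.
by case: ifP => // eX; rewrite (subsetP sX _ eX) in eP.
Qed.

Lemma weight_ge0 E : 0 <= p <= 1 -> 0 <= weight E.
Proof.
move=> /andP[p0 p1].
by apply: prodr_ge0 => e _; case: ifP; rewrite ?subr_ge0.
Qed.

Lemma weight_total : \sum_(G : graph 'I_n) weight (edges G) = 1.
Proof.
rewrite -[RHS](expr0 p) -(cards0 {set 'I_n}) -sum_weight_supset ?sub0set //.
by apply: eq_bigl => G; rewrite sub0set.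
Qed.

Lemma prod_bool (I : finType) (P : {set I}) (b : pred I) :
  \prod_(i in P) (b i)%:R = [forall i in P, b i]%:R :> R.
Proof.
have [/forallP bP|/forallPn[i]] := boolP [forall i in P, b i].
  by rewrite big1 // => i iP; have := bP i; rewrite iP /= => ->.
by rewrite negb_imply => /andP[iP /negPf bi]; rewrite (bigD1 i) //= bi mul0r.
Qed.

Definition star S J : {set {set 'I_n}} :=
  [set [set x.1; x.2] | x in finset.setX S J].

Lemma star_sub_pairs S J : J \subset ~: S ->
  star S J \subset pairs 'I_n.
Proof.
move=> /subsetP JS; apply/subsetP => _ /imsetP[[s w] /setXP[/= sS wJ] ->].
rewrite inE cards2; suff -> : s != w by [].
by apply: contraTneq sS => ->; have := JS _ wJ; rewrite inE.
Qed.

Lemma card_star S J : J \subset ~: S ->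
  #|star S J| = (#|S| * #|J|)%N.
Proof.
move=> /subsetP JS; rewrite -cardsX; apply: card_in_imset.
move=> [s w] [s' w'] /setXP[/= sS wJ] /setXP[/= s'S w'J] eqsw.
have nS u : u \in J -> u \notin S by move=> /JS; rewrite inE.
have : s \in [set s'; w'] by rewrite -eqsw set21.
case/set2P => [ss|sw]; last by move: (nS _ w'J); rewrite -sw sS.
have : w \in [set s'; w'] by rewrite -eqsw set22.
case/set2P => [ws|->]; last by rewrite ss.
by move: (nS _ wJ); rewrite ws s'S.
Qed.

Lemma star_subset S J E :
  (star S J \subset E) = [forall w in J, [forall s in S, [set s; w] \in E]].
Proof.
apply/subsetP/forallP => [sE w|all_sE _ /imsetP[[s w] /setXP[/= sS wJ] ->]].
  apply/implyP => wJ; apply/forallP => s; apply/implyP => sS.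
  by apply: sE; apply/imsetP; exists (s, w); rewrite // inE sS.
by have /implyP/(_ wJ)/forallP/(_ s)/implyP/(_ sS) := all_sE w.
Qed.

(** The events that distinct [w] outside [S] are common neighbours of [S] are
    independent, as they concern disjoint stars.  The proof uses this through
    inclusion-exclusion: both sides are expanded over sets [J] of vertices
    outside [S], and the terms agree by [sum_weight_supset] applied to
    [star S J]. *)
Lemma prob_no_common_nbr S :
  0 <= p <= 1 ->
  \sum_(G : graph 'I_n | ~~ [exists w, common_nbr S (edges G) w])
    weight (edges G) <= (1 - p ^+ #|S|) ^+ (n - #|S|).
Proof.
move=> p01; have w0 E := weight_ge0 E p01.
(* [x E w] is minus the indicator of [w] being a common neighbour, cut off to 0
   on [S] so that only the sets [J] disjoint from [S] contribute. *)
pose x E (w : 'I_n) : R := if w \in S then 0 else - (common_nbr S E w)%:R.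
have xE E (J : {set 'I_n}) : \prod_(w in J) x E w =
    if J \subset ~: S then (-1) ^+ #|J| * (star S J \subset E)%:R else 0.
  case: ifP => [/subsetP JS|/negbT/subsetPn[w wJ]]; last first.
    by rewrite inE negbK => wS; rewrite (bigD1 w) //= /x wS mul0r.
  rewrite star_subset -prod_bool -prodr_const -big_split /=.
  apply: eq_bigr => w /JS; rewrite inE /x => /negPf->.
  by rewrite mulN1r.
apply: (@le_trans _ _ (\sum_(G : graph 'I_n)
    weight (edges G) * \prod_w (x (edges G) w + 1))).
  rewrite big_mkcond; apply: ler_sum => G _; case: ifP => [noG|_].
    rewrite big1 ?mulr1 // => w _; rewrite /x; case: ifP => _; rewrite ?add0r //.
    have /negPf-> : ~~ common_nbr S (edges G) w.
      by apply: contra noG => wG; apply/existsP; exists w.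
    by rewrite oppr0 add0r.
  apply: mulr_ge0 => //; apply: prodr_ge0 => w _; rewrite /x.
  by case: ifP => _; rewrite ?add0r // addrC subr_ge0 lern1 leq_b1.
under eq_bigr do rewrite bigA_distr mulr_sumr.
rewrite exchange_big /=.
have -> : (1 - p ^+ #|S|) ^+ (n - #|S|) =
    \prod_(w : 'I_n) ((if w \in S then 0 else - p ^+ #|S|) + 1).
  have -> : (n - #|S|)%N = #|~: S|.
    by have := cardsC S; rewrite card_ord; lia.
  rewrite -prodr_const [LHS]big_mkcond; apply: eq_bigr => w _.
  by rewrite inE; case: (w \in S) => /=; rewrite ?add0r // addrC.
rewrite bigA_distr le_eqVlt; apply/orP; left; apply/eqP.
apply: eq_bigr => J _.
rewrite -[RHS]big_mkcond /=.
have split_x G : \prod_i (if i \in J then x (edges G) i else 1) =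
  if J \subset ~: S then (-1) ^+ #|J| * (star S J \subset edges G)%:R else 0.
  by rewrite -big_mkcond xE.
under eq_bigr do rewrite split_x.
have [JS|/subsetPn[w wJ]] := boolP (J \subset ~: S); last first.
  rewrite inE negbK => wS; rewrite (bigD1 w) //= wS mul0r.
  by rewrite big1 // => G _; rewrite mulr0.
transitivity ((-1) ^+ #|J| * p ^+ (#|S| * #|J|)).
  rewrite -card_star // -sum_weight_supset ?star_sub_pairs // mulr_sumr.
  rewrite [RHS]big_mkcond; apply: eq_bigr => G _.
  by case: ifP => _; rewrite ?mulr0 // mulr1 mulrC.
rewrite exprM -exprMn mulN1r -prodr_const; apply: eq_bigr => w wJ.
by have := subsetP JS _ wJ; rewrite inE => /negPf->.
Qed.

Lemma bin_le_expn a b : ('C(a, b) <= a ^ b)%N.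
Proof.
apply: (@leq_trans ('C(a, b) * b`!)); first by rewrite leq_pmulr ?fact_gt0.
rewrite bin_ffact; elim: b => // b IHb; rewrite ffactnSr expnSr.
by rewrite leq_mul // leq_subr.
Qed.

(** If some set of at most [M] vertices has no common neighbour, then neither
    has any set of exactly [M] vertices above it, so the union bound runs over
    the sets of size [M] only. *)
Lemma prob_not_extendable M : 0 <= p <= 1 -> (M <= n)%N ->
  \sum_(G : graph 'I_n | ~~ extendable M G) weight (edges G) <=
  n%:R ^+ M * (1 - p ^+ M) ^+ (n - M).
Proof.
move=> p01 Mn; have /andP[p0 p1] := p01.
have w0 E := weight_ge0 E p01.
apply: (@le_trans _ _ (\sum_(S : {set 'I_n} | #|S| == M)
    \sum_(G : graph 'I_n | ~~ [exists w, common_nbr S (edges G) w])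
      weight (edges G))).
  rewrite big_mkcond (exchange_big_dep xpredT) //=; apply: ler_sum => G _.
  case: ifP => [|_]; last exact: sumr_ge0.
  move=> /forallPn[S]; rewrite negb_imply => /andP[SM noS].
  have [|S' S'C cS'] := @exists_subset_card _ (~: S) (M - #|S|).
    by have := cardsC S; rewrite card_ord; lia.
  have cSS' : #|S :|: S'| == M.
    rewrite cardsU; have -> : S :&: S' = set0.
      by rewrite setIC; apply/eqP; rewrite setI_eq0 disjoints_subset.
    by rewrite cards0; lia.
  rewrite (bigD1 (S :|: S')) /= ?cSS' //.
    by rewrite lerDl sumr_ge0.
  apply: contra noS => /existsP[w /forallP wP]; apply/existsP; exists w.
  by apply/forallP => s; apply/implyP => sS; have := wP s; rewrite inE sS.
apply: (@le_trans _ _ (\sum_(S : {set 'I_n} | #|S| == M)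
    (1 - p ^+ M) ^+ (n - M))).
  by apply: ler_sum => S /eqP <-; apply: prob_no_common_nbr.
rewrite sumr_const -[X in _ *+ X]cardsE card_draws card_ord -[leLHS]mulr_natl.
rewrite ler_wpM2r //; last by rewrite -natrX ler_nat bin_le_expn.
by rewrite exprn_ge0 // subr_ge0 exprn_ile1.
Qed.

Lemma Gnp_prob_extendable M (A : pred (graph 'I_n)) :
  0 <= p <= 1 -> (M <= n)%N -> (forall G, extendable M G -> A G) ->
  1 - n%:R ^+ M * (1 - p ^+ M) ^+ (n - M) <= Gnp_prob p A <= 1.
Proof.
move=> p01 Mn extA.
have w0 E := weight_ge0 E p01.
have := weight_total; rewrite (bigID A) /= -/(Gnp_prob p A).
set PA := Gnp_prob p A; set Q := (X in _ + X = _) => PQ.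
have Q0 : 0 <= Q by apply: sumr_ge0.
have QM : Q <= n%:R ^+ M * (1 - p ^+ M) ^+ (n - M).
  apply: le_trans (prob_not_extendable p01 Mn).
  rewrite [leLHS]big_mkcond [leRHS]big_mkcond; apply: ler_sum => G _.
  case: ifP => [nA|_]; last by case: ifP.
  by rewrite ifT //; apply: contra nA; apply: extA.
by apply/andP; split; lra.
Qed.
End RandomGraph.

(** * The limit *)

From mathcomp Require Import all_classical all_reals all_analysis.
Import Order.TTheory GRing.Theory Num.Theory numFieldNormedType.Exports.
Local Open Scope classical_set_scope.
Local Open Scope ring_scope.

(** With [y := (n - M) * p ^+ M] the left-hand side is at most
    [n ^+ M * expR (- y)], and [y ^+ 2] is at least [n / 4].  The term of degree
    [2 * M + 2] of the exponential series of [y] then beats [n ^+ M] by a factor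
    of order [n]. *)
Lemma union_bound_le_inv (R : realType) (M n : nat) (p : R) :
  0 <= p <= 1 -> n%:R^-1 <= p ^+ (2 * M + 3) -> (2 * M < n)%N ->
  n%:R ^+ M * (1 - p ^+ M) ^+ (n - M) <=
  4 ^+ M.+1 * (2 * M + 2)`!%:R / n%:R.
Proof.
move=> /andP[p0 p1] np Mn.
have n0 : 0 < n%:R :> R by rewrite ltr0n; lia.
pose y : R := (n - M)%:R * p ^+ M.
have y0 : 0 <= y by rewrite mulr_ge0 ?exprn_ge0.
have pM1 : p ^+ M <= 1 by rewrite exprn_ile1.
have le_exp : (1 - p ^+ M) ^+ (n - M) <= (expR y)^-1.
  rewrite -expRN -mulrN expRM_natl lerXn2r ?nnegrE ?subr_ge0 ?expR_ge0 //.
  exact: expR_ge1Dx.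
have y2 : n%:R / 4 <= y ^+ 2.
  have p2M : n%:R^-1 <= (p ^+ M) ^+ 2.
    rewrite -exprM mulnC (le_trans np) // exprD ler_piMr ?exprn_ge0 //.
    by rewrite exprn_ile1.
  have nM : n%:R / 2 <= (n - M)%:R :> R.
    by rewrite ler_pdivrMr // -natrM ler_nat; lia.
  have -> : n%:R / 4 = (n%:R / 2) ^+ 2 * n%:R^-1 :> R.
    by field; rewrite lt0r_neq0.
  have n2 : 0 <= n%:R / 2 :> R by rewrite divr_ge0 ?ltW.
  rewrite /y [leRHS]exprMn; apply: ler_pM; rewrite ?exprn_ge0 ?invr_ge0 ?(ltW n0) //.
  by rewrite lerXn2r ?nnegrE.
set f := (_ `!)%:R.
have f0 : 0 < f :> R by rewrite ltr0n fact_gt0.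
have yexp : (n%:R / 4) ^+ M.+1 / f <= expR y.
  apply: le_trans (_ : y ^+ (2 * M + 2) / f <= _).
    rewrite ler_pM2r ?invr_gt0 // (_ : 2 * M + 2 = 2 * M.+1)%N; last lia.
    have n4 : 0 <= n%:R / 4 :> R by rewrite divr_ge0 ?ltW.
    by rewrite [leRHS]exprM lerXn2r ?nnegrE ?exprn_ge0.
  have := expR_ge1Dxn (2 * M).+1 y0; rewrite /f addn2; lra.
have pos : 0 < (n%:R / 4) ^+ M.+1 / f by rewrite divr_gt0 ?exprn_gt0 ?divr_gt0.
apply: le_trans (_ : n%:R ^+ M * ((n%:R / 4) ^+ M.+1 / f)^-1 <= _).
  rewrite ler_pM2l ?exprn_gt0 // (le_trans le_exp) // lef_pV2 ?posrE ?expR_gt0 //.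
rewrite le_eqVlt; apply/orP; left; apply/eqP.
rewrite expr_div_n !exprS; field.
by rewrite !expf_neq0 ?lt0r_neq0.
Qed.

(** The logarithmic factor is used only through [1 <= ln n], that is
    [expR 1 <= n]. *)
Lemma inv_le_expr (R : realType) (k n : nat) (p : R) :
  (0 < n)%N -> expR 1 <= n%:R :> R ->
  n%:R `^ (- (2 * k%:R + 3)^-1) * ln n%:R <= p ->
  n%:R^-1 <= p ^+ (2 * k + 3).
Proof.
move=> n0 en np.
have n0R : 0 < n%:R :> R by rewrite ltr0n.
set a := n%:R `^ _ in np.
have a0 : 0 <= a by apply: powR_ge0.
have ap : a <= p.
  apply: le_trans np; rewrite ler_peMr // -[leLHS](expRK 1).
  by rewrite ler_ln ?posrE ?expR_gt0.
suff <- : a ^+ (2 * k + 3) = n%:R^-1 by rewrite lerXn2r ?nnegrE ?(le_trans a0).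
rewrite -powR_mulrn // -powRrM -[RHS]powR_inv1 ?ler0n //; congr (_ `^ _).
rewrite natrD natrM mulNr mulVf //.
Qed.

Theorem theorem1p4 (R : realType) (U : finType) (F : graph U)
    (hF : (1 <= min_degree F)%N)
    (hD : exists D : R, forall n : nat,
      ((min_degree F)%:R - 1) * n%:R + D <= (wsatK n F)%:R) :
  exists (k : nat) (dF : R),
    [/\ (0 < k)%N,
        \forall n \near \oo,
          (wsatK n F)%:R = ((min_degree F)%:R - 1) * n%:R + dF &
        forall p : nat -> R,
          (forall n, 0 <= p n <= 1) ->
          (\forall n \near \oo,
            n%:R `^ (- (2 * k%:R + 3)^-1) * ln n%:R <= p n) ->
          (fun n => Gnp_prob (p n) (fun G : graph 'I_n => wsat G F == wsatK n F))
            @ \oo --> (1 : R)].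
Proof.
have dE : (min_degree F)%:R - 1 = (min_degree F).-1%:R :> R.
  by rewrite -{1}(prednK hF) -natr1 addrK.
have hDnat : exists D, forall n, ((min_degree F).-1 * n <= wsatK n F + D)%N.
  have [D hD'] := hD; exists (Num.bound `|D|) => n.
  rewrite -(ler_nat R) natrD natrM -dE.
  have := hD' n; have := archi_boundP (normr_ge0 D); have := ler_norm (- D).
  by rewrite normrN; lra.
have [N UN linear] := wsatK_eventually_linear hF hDnat.
set M := (N + 2 * #|U| + 2)%N in linear.
exists M, ((wsatK N F)%:R - ((min_degree F)%:R - 1) * N%:R).
split; first by rewrite /M addn2.
  near=> n; have Mn : (M < n)%N by near: n; exact: nbhs_infty_gt.
  rewrite linear // natrD natrM natrB ?dE; first by ring.
  by rewrite /M in Mn; lia.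
move=> p p01 p_ge.
(* The factor 2 absorbs the shift from [1 / n] to [harmonic n = 1 / n.+1]. *)
pose C : R := 2 * (4 ^+ M.+1 * (2 * M + 2)`!%:R).
have lim1 : (fun n => 1 - C * harmonic n) @ \oo --> (1 : R).
  rewrite -[X in _ --> X]subr0 -(mulr0 C).
  by apply: cvgB; [exact: cvg_cst | apply: cvgMr; exact: cvg_harmonic].
apply: (squeeze_cvgr _ lim1 (cvg_cst _)).
near=> n; have Mn : (2 * M < n)%N by near: n; exact: nbhs_infty_gt.
have n0 : (0 < n)%N by lia.
have en : expR 1 <= n%:R :> R.
  apply: ltW; apply: lt_le_trans (archi_boundP (expR_ge0 1)) _.
  by rewrite ler_nat; near: n; exact: nbhs_infty_ge.
have np : n%:R^-1 <= p n ^+ (2 * M + 3).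
  by apply: inv_le_expr => //; near: n.
have extA (G : graph 'I_n) : extendable M G -> wsat G F == wsatK n F.
  move=> ext; apply/eqP; apply: (wsat_extendable hF UN _ _ ext); first by lia.
  by apply: linear; lia.
have [|lo ->] := andP (Gnp_prob_extendable (p01 n) _ extA); first by lia.
rewrite andbT; apply: le_trans lo; rewrite lerD2l lerN2.
apply: le_trans (union_bound_le_inv (p01 n) np Mn) _.
rewrite /C /harmonic /=; set c := _ * _`!%:R.
have c0 : 0 <= c by rewrite mulr_ge0 ?exprn_ge0.
rewrite [2 * c]mulrC -[leRHS]mulrA ler_wpM2l //.
rewrite ler_pdivlMr ?ltr0n // mulrC ler_pdivrMr ?ltr0n //.
by rewrite -natrM ler_nat; lia.
Unshelve. all: by end_near.
Qed.
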